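(* For every real number $r$ with $1\le r<\infty$, the function $f:\mathbb{R}\to\mathbb{R}$, $$f(x)=\frac{1-|x|}{1-|x|^r},$$ is positive definite on $\mathbb{R}$.
   Context: Convention: when $|x|=1$, the quotient is interpreted as its limiting value $f(x)=1/r$. Definition. A continuous function $h:\mathbb{R}\to\mathbb{R}$ is called positive definite if for every $m\ge 1$ and every choice of real numbers $x_1,\dots,x_m$ the $m\times m$ matrix $[h(x_i-x_j)]$ is positive semidefinite. *)

(* Defs.v *)
From HB Require Import structures.
From mathcomp Require Import all_boot all_order all_algebra.
From mathcomp Require Import all_classical all_reals all_analysis.
Set Implicit Arguments.
Unset Strict Implicit.
Unset Printing Implicit Defensive.
Import Order.TTheory GRing.Theory Num.Theory.
Import numFieldNormedType.Exports.
Local Open Scope ring_scope.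

Definition psdmx (R : realType) (m : nat) (A : 'M[R]_m) : Prop :=
  A \is symmetricmx /\ forall c : 'cV[R]_m, 0 <= (c^T *m A *m c) ord0 ord0.

Definition positive_definite (R : realType) (h : R -> R) : Prop :=
  continuous h /\
  forall (m : nat) (x : 'I_m -> R), (1 <= m)%N ->
    psdmx (\matrix_(i < m, j < m) h (x i - x j)).

(* At |x| = 1 the quotient is 0 / 0, so its limit 1 / r is put in by hand.
   For r <> 0, powR gives 0 `^ r = 0, hence f 0 = 1. *)
Definition f (R : realType) (r x : R) : R :=
  if `|x| == 1 then r^-1 else (1 - `|x|) / (1 - `|x| `^ r).

(* Main.v *)
Require Import Defs.
From mathcomp Require Import all_boot all_order all_algebra.
From mathcomp Require Import all_classical all_reals all_analysis.
From mathcomp Require Import ring lra measurable_realfun.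
Import Order.TTheory GRing.Theory Num.Theory.
Import numFieldNormedType.Exports.
Local Open Scope ring_scope.

(** The function is positive definite by Polya's criterion: on [0, +oo[ it is
    bounded, nonnegative and convex, and every continuous even function with
    such a profile is a positive mixture of a constant and of the triangle
    functions x |-> max 0 (a - |x|).

    A triangle function is positive definite because max 0 (a - |x - y|) is the
    length of [x, x + a] /\ [y, y + a]: its matrices are Gram matrices of
    indicator functions ([gram_measure_ge0], [pd_kernel_triangle]).  Only
    finitely many distances |x_i - x_j| occur in one matrix, so the mixture can
    be taken finite: the piecewise linear interpolation of the profile at these
    distances is a nonnegative combination of triangles and a constant
    ([convex_interpolation_pd], [polya_pd_kernel]).

    Convexity is the real content.  With D(t) = t^r - 1 and
      B(t) = (r - 1) t^(r+1) - (r + 1) t^r + (r + 1) t - (r - 1)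
    ([curvature_num]), the profile has second derivative
    r t^(r-2) B(t) / D(t)^3 away from t = 1.  The function B is nondecreasing,
    since B'(t) = (r + 1) ((r - 1) t^r - r t^(r-1) + 1) is nonnegative by
    Young's inequality, and B(1) = 0; so B(t) and D(t) are nonpositive for
    t < 1, nonnegative for t > 1, and the profile is convex on [0, 1] and on
    [1, +oo[.  The sign of B also says that the graph lies above its tangent at
    t = 1, which lets the two halves be glued ([chord_convex_f]). *)

Local Open Scope classical_set_scope.

(** * Positive definite kernels of the distance *)

Definition pd_kernel {R : realType} (h : R -> R) : Prop :=
  forall (m : nat) (x c : 'I_m -> R),
    0 <= \sum_i \sum_j c i * c j * h `|x i - x j|.

(** The quadratic form is the integral of the square of the sum over i of c i
    times the indicator function of A i. *)
Lemma gram_measure_ge0 {d : measure_display} {T : measurableType d}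
    {R : realType} (mu : {measure set T -> \bar R}) (m : nat)
    (A : 'I_m -> set T) (c : 'I_m -> R) :
  (forall i, measurable (A i)) -> (forall i, (mu (A i) < +oo)%E) ->
  0 <= \sum_i \sum_j c i * c j * fine (mu (A i `&` A j)).
Proof.
move=> mA finA.
have mAI i j : measurable (A i `&` A j) by exact: measurableI.
have finAI i j : (mu (A i `&` A j) < +oo)%E.
  by apply: le_lt_trans (finA i); apply: le_measure; rewrite ?inE//; exact: subIsetl.
have int1 i j : mu.-integrable setT (EFin \o (\1_(A i `&` A j) : T -> R)).
  apply/integrableP; split; first exact/measurable_EFinP/measurable_indic.
  under eq_integral do rewrite /= ger0_norm//.
  by rewrite integral_indic// setIT.
have intc i j : mu.-integrable setT
    (fun x => (c i * c j)%:E * (\1_(A i `&` A j) x)%:E)%E.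
  by have := integrableZl measurableT (c i * c j) (int1 i j).
suff -> : \sum_i \sum_j c i * c j * fine (mu (A i `&` A j)) =
    fine (\int[mu]_x (((\sum_i c i * \1_(A i) x) ^+ 2)%:E))%E.
  by apply/fine_ge0/integral_ge0 => x _; rewrite lee_fin sqr_ge0.
have -> : (fun x => ((\sum_i c i * \1_(A i) x) ^+ 2)%:E) =
    (fun x => \sum_i \sum_j (c i * c j)%:E * (\1_(A i `&` A j) x)%:E)%E.
  apply/funext => x.
  under [RHS]eq_bigr do rewrite sumEFin.
  rewrite sumEFin expr2 big_distrl/=; congr EFin; apply: eq_bigr => i _.
  rewrite big_distrr/=; apply: eq_bigr => j _.
  by rewrite indicI/=; ring.
rewrite integral_sum//; last by move=> i; apply: integrable_sum.
rewrite -sum_fine; last first.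
  by move=> i _; apply: integrable_fin_num => //; apply: integrable_sum.
apply: eq_bigr => i _; rewrite integral_sum// -sum_fine; last first.
  by move=> j _; exact: integrable_fin_num.
apply: eq_bigr => j _.
rewrite (integralZl measurableT (int1 i j))/= integral_indic// setIT fineM//.
by rewrite ge0_fin_numE.
Qed.

Lemma fine_lebesgue_measure_translatesI {R : realType} (a x y : R) :
  fine (lebesgue_measure (`[x, x + a] `&` `[y, y + a]%classic)) =
    Num.max 0 (a - `|x - y|).
Proof.
wlog xy : x y / x <= y => [hw|].
  have [/hw//|/ltW yx] := leP x y.
  by rewrite setIC (hw y x)// distrC.
have -> : `[x, x + a] `&` `[y, y + a] = `[y, x + a]%classic.
  apply/seteqP; split=> z /=; rewrite !in_itv/=; first by lra.
  by move=> ?; split; lra.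
rewrite lebesgue_measure_itv/= lte_fin ler0_norm ?subr_le0//.
by case: ifPn; rewrite -?leNgt => h; [rewrite max_r|rewrite max_l]; rewrite /=; lra.
Qed.

Lemma pd_kernel_cst {R : realType} (a : R) : 0 <= a -> pd_kernel (fun=> a).
Proof.
move=> a0 m x c.
suff -> : \sum_i \sum_j c i * c j * a = (\sum_i c i) ^+ 2 * a.
  by rewrite mulr_ge0// sqr_ge0.
rewrite expr2 mulr_suml mulr_suml; apply: eq_bigr => i _.
by rewrite mulr_sumr mulr_suml.
Qed.

Lemma pd_kernelD {R : realType} (h k : R -> R) :
  pd_kernel h -> pd_kernel k -> pd_kernel (fun u => h u + k u).
Proof.
move=> ph pk m x c; have := addr_ge0 (ph m x c) (pk m x c).
rewrite -big_split/=; congr (0 <= _); apply: eq_bigr => i _.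
by rewrite -big_split/=; apply: eq_bigr => j _; rewrite mulrDr.
Qed.

Lemma pd_kernelZ {R : realType} (a : R) (h : R -> R) :
  0 <= a -> pd_kernel h -> pd_kernel (fun u => a * h u).
Proof.
move=> a0 ph m x c; have := mulr_ge0 a0 (ph m x c).
rewrite mulr_sumr; congr (0 <= _); apply: eq_bigr => i _.
by rewrite mulr_sumr; apply: eq_bigr => j _; rewrite mulrCA.
Qed.

Lemma pd_kernel_triangle {R : realType} (a : R) :
  pd_kernel (fun u => Num.max 0 (a - u)).
Proof.
move=> m x c.
pose A i : set R := `[x i, x i + a]%classic.
have mA i : measurable (A i) by exact: measurable_itv.
have finA i : (lebesgue_measure (A i) < +oo)%E.
  by rewrite /A lebesgue_measure_itv/=; case: ifPn => _; rewrite ?ltry// -EFinD ltry.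
have := gram_measure_ge0 lebesgue_measure m A c mA finA.
congr (0 <= _); apply: eq_bigr => i _; apply: eq_bigr => j _.
by rewrite fine_lebesgue_measure_translatesI.
Qed.

(** * Polya's criterion *)

(** Convexity on [0, +oo[, as the position of the graph over b below the chord
    over [a, c].  Clearing the denominator c - a keeps the comparison with
    interpolating lines within linear arithmetic in the values of h. *)
Definition chord_convex {R : realType} (h : R -> R) : Prop :=
  forall a b c, 0 <= a -> a < b -> b < c ->
    h b * (c - a) <= h a * (c - b) + h c * (b - a).

Section polya.
Context {R : realType} (h : R -> R) (M : R).
Hypothesis h_ge0 : forall t, 0 <= t -> 0 <= h t.
Hypothesis h_le : forall t, 0 <= t -> h t <= M.
Hypothesis h_convex : chord_convex h.

(** A convex function that increases somewhere grows at least linearly from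
    there on, against the bound M. *)
Lemma bounded_convex_nonincreasing s t : 0 <= s -> s <= t -> h t <= h s.
Proof.
move=> s0; rewrite le_eqVlt => /predU1P[->//|st]; rewrite leNgt; apply/negP => hst.
have sM := h_le _ s0.
(* The line through s and t is already above M at c - 1. *)
set c := t + (t - s) * (M - h s) / (h t - h s) + 1.
have k0 : 0 <= (t - s) * (M - h s) / (h t - h s).
  by rewrite divr_ge0 ?mulr_ge0//; lra.
have tc : t < c by rewrite /c; lra.
have c0 : 0 <= c by lra.
have := h_convex s t c s0 st tc.
have hc := h_le _ c0.
have e : (h t - h s) * (c - t - 1) = (t - s) * (M - h s).
  by rewrite /c; field; lra.
nra.
Qed.

(** Induction on the interpolation nodes t :: s, the smallest node being added
    last.  The interpolant k is extended to the left of t by its first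
    linear piece, where convexity keeps it below h; hence adding a node to the
    left of t only requires a nonnegative multiple of the triangle ending at t,
    which leaves the values at the old nodes unchanged. *)
Lemma convex_interpolation_pd t s : path <%R t s -> 0 <= t ->
  exists k : R -> R, exists p : R,
    [/\ pd_kernel k, {in t :: s, k =1 h},
        forall u, u <= t -> k u = h t + p * (u - t) &
        forall u, 0 <= u -> u <= t -> k u <= h u].
Proof.
elim: s t => [|t1 s IH] t /=.
  move=> _ t0; exists (fun=> h t), 0; split.
  - exact/pd_kernel_cst/h_ge0.
  - by move=> u; rewrite inE => /eqP ->.
  - by move=> u _; rewrite mul0r addr0.
  - by move=> u u0 ut; exact: bounded_convex_nonincreasing.
move=> /andP[tt1 pths] t0.
have t1_ge0 : 0 <= t1 by lra.
have [k [p [pk kh klin kle]]] := IH _ pths t1_ge0.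
have kt : k t <= h t by apply: kle => //; lra.
(* The change of slope at t1; it is nonnegative because k is below h. *)
pose d := (h t - k t) / (t1 - t).
have d0 : 0 <= d by rewrite divr_ge0//; lra.
have dE : d * (t1 - t) = h t - k t by rewrite /d; field; lra.
have ktE : k t = h t1 + p * (t - t1) by apply: klin; lra.
pose k' u := k u + d * Num.max 0 (t1 - u).
have k'lin u : u <= t -> k' u = h t + (p - d) * (u - t).
  move=> ut; rewrite /k' max_r ?klin; [|lra|lra].
  by move: dE; rewrite ktE => dE; lra.
exists k', (p - d); split=> //.
- by apply: pd_kernelD => //; apply: pd_kernelZ => //; exact: pd_kernel_triangle.
- move=> u; rewrite inE => /predU1P[->|us].
    by rewrite k'lin// subrr mulr0 addr0.
  rewrite /k' kh// max_l ?mulr0 ?addr0// subr_le0.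
  move: us; rewrite inE => /predU1P[->//|us].
  have /allP := order_path_min lt_trans pths.
  by move=> /(_ _ us)/ltW.
- move=> u u0; rewrite le_eqVlt => /predU1P[->|ut].
    by rewrite k'lin// subrr mulr0 addr0.
  have := h_convex u t t1 u0 ut tt1.
  have : k' u * (t1 - t) = h t * (t1 - u) - h t1 * (t - u).
    rewrite k'lin ?ltW//; move: dE; rewrite ktE => dE.
    have -> : h t = h t1 + p * (t - t1) + d * (t1 - t) by lra.
    by ring.
  move=> e1 e2; have : k' u * (t1 - t) <= h u * (t1 - t) by lra.
  by rewrite ler_pM2r//; lra.
Qed.

Lemma polya_pd_kernel : pd_kernel h.
Proof.
move=> m x c.
pose s := undup [seq `|x ij.1 - x ij.2| | ij : 'I_m * 'I_m].
have hs i j : `|x i - x j| \in sort <=%R s.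
  by rewrite mem_sort mem_undup; apply/mapP; exists (i, j) => //; rewrite mem_enum.
have s_lt : sorted <%R (sort <=%R s).
  by rewrite lt_sorted_uniq_le sort_uniq undup_uniq sort_sorted//; exact: le_total.
have s_ge0 u : u \in sort <=%R s -> 0 <= u.
  by rewrite mem_sort mem_undup => /mapP[ij _ ->].
have [k pk kh] : exists2 k, pd_kernel k & {in sort <=%R s, k =1 h}.
  case: (sort <=%R s) s_lt s_ge0 => [_ _|t l /= tl l0].
    by exists (fun=> 0) => //; exact: pd_kernel_cst.
  have [k [p [pk kh _ _]]] := convex_interpolation_pd _ _ tl (l0 _ (mem_head _ _)).
  by exists k.
have := pk m x c; congr (0 <= _); apply: eq_bigr => i _; apply: eq_bigr => j _.
by rewrite kh.
Qed.

End polya.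

(** * Derivatives *)

Lemma is_derive1_inv {R : realType} (g : R -> R) (x dg : R) :
  g x != 0 -> is_derive x 1 g dg ->
  is_derive x 1 (fun y => (g y)^-1) (- dg / g x ^+ 2).
Proof.
move=> gx0 [derg <-]; split; first exact: derivableV.
by rewrite deriveV// scaleNr mulNr; congr (- _); exact: mulrC.
Qed.

Lemma near_neq {R : realType} (t a : R) : t != a -> \forall u \near t, u != a.
Proof.
rewrite neq_lt => /orP[/lt_nbhsl|/lt_nbhsr] h.
  by apply: filterS h => u ua; rewrite lt_eqF.
by apply: filterS h => u au; rewrite gt_eqF.
Qed.

(** * The ratio (1 - t) / (1 - t^r) on the half-line *)

Section ratio.
Set Implicit Arguments.
Unset Strict Implicit.
Context {R : realType} (r : R).
Hypothesis r1 : 1 <= r.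

Let r_gt0 : 0 < r. Proof. exact: lt_le_trans ltr01 r1. Qed.

Lemma powRB1 (t : R) : 0 < t -> t `^ r = t * t `^ (r - 1).
Proof. by move=> t0; rewrite mulr_powRB1// ltW. Qed.

Lemma powRB2 (t : R) : 0 < t -> t `^ (r - 1) = t * t `^ (r - 2).
Proof.
move=> t0; rewrite (_ : r - 1 = 1 + (r - 2)); last by ring.
rewrite (@powRD _ t 1 (r - 2)) ?(gt_eqF t0) ?implybT//.
by rewrite powRr1 ?ltW.
Qed.

Lemma powRD1 (t : R) : 0 <= t -> t `^ (r + 1) = t * t `^ r.
Proof.
move=> t0; have r10 : 0 < r + 1 by rewrite addr_gt0.
by rewrite mulrC (@powRD _ t r 1) ?(gt_eqF r10)// powRr1.
Qed.

(** Young's inequality for the product of 1 and t^(r-1), with the conjugate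
    exponents r and r / (r - 1): the value at 1 of the r-th power lies above the
    tangent line at t. *)
Lemma powR_tangent_le (t : R) : 0 < t ->
  r * t `^ (r - 1) <= (r - 1) * t `^ r + 1.
Proof.
move=> t0; have [->|rn1] := eqVneq r 1.
  by rewrite subrr powRr0 mul0r; lra.
have r_gt1 : 0 < r - 1 by rewrite subr_gt0 lt_neqAle eq_sym rn1.
pose q := r / (r - 1).
have q0 : 0 < q by rewrite divr_gt0.
have e : r^-1 + q^-1 = 1 by rewrite /q; field; lra.
have := @conjugate_powR R 1 (t `^ (r - 1)) r q ler01 (powR_ge0 _ _) r_gt0 q0 e.
rewrite mul1r powR1 -powRrM (_ : (r - 1) * q = r); last by rewrite /q; field; lra.
rewrite -(ler_pM2l r_gt0); congr (_ <= _).
by rewrite /q; field; lra.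
Qed.

(** The numerator of the second derivative of f r, up to the positive factor
    r t^(r-2); see [is_derive2_f]. *)
Definition curvature_num (t : R) : R :=
  (r - 1) * t `^ (r + 1) - (r + 1) * t `^ r + (r + 1) * t - (r - 1).

Lemma is_derive_curvature_num (t : R) : 0 < t ->
  is_derive t 1 curvature_num
    ((r + 1) * ((r - 1) * t `^ r - r * t `^ (r - 1) + 1)).
Proof.
move=> t0.
have d1 := is_derive1_powR (r + 1) t0.
have d2 := is_derive1_powR r t0.
rewrite /curvature_num.
apply: is_derive_eq.
rewrite /GRing.scale/= addrK; ring.
Qed.

Lemma curvature_num_le (s t : R) : 0 < s -> s <= t ->
  curvature_num s <= curvature_num t.
Proof.
move=> s0 st.
have dt u : s <= u -> is_derive u 1 curvature_num
    ((r + 1) * ((r - 1) * u `^ r - r * u `^ (r - 1) + 1)).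
  by move=> su; apply: is_derive_curvature_num; lra.
have [||u us e] := @MVT_segment R curvature_num
    (fun u => (r + 1) * ((r - 1) * u `^ r - r * u `^ (r - 1) + 1)) s t st.
- by move=> u; rewrite in_itv/= => /andP[su _]; apply: dt; exact: ltW.
- apply: derivable_within_continuous => u; rewrite in_itv/= => /andP[su _].
  by have [] := dt u su.
rewrite -subr_ge0 e mulr_ge0 ?subr_ge0// mulr_ge0//.
  by rewrite addr_ge0 ?ler01// ltW.
have /powR_tangent_le : 0 < u by move: us; rewrite in_itv/=; lra.
by lra.
Qed.

Lemma curvature_num1 : curvature_num 1 = 0.
Proof. by rewrite /curvature_num !powR1; ring. Qed.

Lemma curvature_num_sign (t : R) : 0 <= t -> 0 <= (t - 1) * curvature_num t.
Proof.
rewrite le_eqVlt => /predU1P[<-|t0].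
  rewrite /curvature_num !powR0 ?gt_eqF//; last by rewrite addr_gt0.
  by have := r1; lra.
have [t1|/ltW t1] := leP t 1.
  apply: mulr_le0; first by rewrite subr_le0.
  by have := curvature_num_le t0 t1; rewrite curvature_num1.
apply: mulr_ge0; first by rewrite subr_ge0.
by have := curvature_num_le ltr01 t1; rewrite curvature_num1.
Qed.

Lemma powR_sub1_sign (t : R) : 0 <= t -> t != 1 ->
  0 < (t - 1) * (t `^ r - 1).
Proof.
have p1 : 1 `^ r = 1 :> R by rewrite powR1.
move=> t0 tn1; have [t1|t1|t1] := ltgtP t 1; last by rewrite t1 eqxx in tn1.
- rewrite nmulr_rgt0 subr_lt0// -[ltRHS]p1.
  by rewrite gt0_ltr_powR// nnegrE.
- rewrite pmulr_rgt0 subr_gt0// -[ltLHS]p1.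
  by rewrite gt0_ltr_powR// nnegrE.
Qed.

Lemma powR_sub1_neq0 (t : R) : 0 <= t -> t != 1 -> t `^ r - 1 != 0.
Proof.
move=> t0 tn1; have := powR_sub1_sign t0 tn1.
by rewrite lt0r mulf_eq0 negb_or => /andP[/andP[]].
Qed.

Lemma f_abs (x : R) : f r `|x| = f r x.
Proof. by rewrite /f normr_id. Qed.

Lemma f_at1 : f r 1 = r^-1.
Proof. by rewrite /f normr1 eqxx. Qed.

Lemma f_ratio (t : R) : 0 <= t -> t != 1 -> f r t = (t - 1) / (t `^ r - 1).
Proof.
move=> t0 tn1; rewrite /f ger0_norm// (negbTE tn1).
by rewrite -(opprB t 1) -(opprB (t `^ r) 1) invrN mulrNN.
Qed.

Lemma f_ge0 (t : R) : 0 <= t -> 0 <= f r t.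
Proof.
move=> t0; have [->|tn1] := eqVneq t 1; first by rewrite f_at1 invr_ge0 ltW.
have := powR_sub1_sign t0 tn1; have := powR_sub1_neq0 t0 tn1.
move=> D0 s; rewrite f_ratio//.
have -> : (t - 1) / (t `^ r - 1) = (t - 1) * (t `^ r - 1) / (t `^ r - 1) ^+ 2.
  by field.
by rewrite divr_ge0 ?sqr_ge0// ltW.
Qed.

Lemma f_le1 (t : R) : 0 <= t -> f r t <= 1.
Proof.
move=> t0; have [->|tn1] := eqVneq t 1; first by rewrite f_at1 invf_le1.
have s := powR_sub1_sign t0 tn1.
rewrite f_ratio//; have [t1|t1|t1] := ltgtP t 1; last by rewrite t1 eqxx in tn1.
- have D : t `^ r - 1 < 0 by move: s; rewrite nmulr_rgt0// subr_lt0.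
  rewrite ler_ndivrMr// mul1r lerD2r.
  move: t0; rewrite le_eqVlt => /predU1P[<-|t0]; first by rewrite powR0// gt_eqF.
  by rewrite ge1r_powR// t0 ltW.
- have D : 0 < t `^ r - 1 by move: s; rewrite pmulr_rgt0// subr_gt0.
  by rewrite ler_pdivrMr// mul1r lerD2r le1r_powR// ltW.
Qed.

(** The slope - (r - 1) / (2 r) is the derivative of f r at 1.  After clearing
    denominators, the inequality becomes the sign of [curvature_num]. *)
Lemma f_ge_tangent1 (t : R) : 0 <= t ->
  r^-1 - (r - 1) / (2 * r) * (t - 1) <= f r t.
Proof.
move=> t0; have [->|tn1] := eqVneq t 1; first by rewrite f_at1; lra.
have D := powR_sub1_neq0 t0 tn1; have s := powR_sub1_sign t0 tn1.
have B := curvature_num_sign t0.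
have e : f r t - (r^-1 - (r - 1) / (2 * r) * (t - 1)) =
    ((t - 1) * curvature_num t) / (2 * r * ((t - 1) * (t `^ r - 1))).
  rewrite f_ratio// /curvature_num powRD1//.
  by field; rewrite D subr_eq0 tn1 gt_eqF.
rewrite -subr_ge0 e; apply: divr_ge0 => //.
by rewrite mulr_ge0 ?ltW// mulr_gt0.
Qed.

Lemma is_derive_f (t : R) : 0 < t -> t != 1 ->
  is_derive t 1 (f r)
    ((t `^ r - 1 - (t - 1) * (r * t `^ (r - 1))) / (t `^ r - 1) ^+ 2).
Proof.
move=> t0 tn1; have D := powR_sub1_neq0 (ltW t0) tn1.
apply: (@near_eq_is_derive R R^o R^o (fun u => (u - 1) * (u `^ r - 1)^-1)).
  near=> u; rewrite f_ratio//.
    by apply: ltW; near: u; exact: lt_nbhsr.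
  by near: u; exact: near_neq.
(* d2 and d4 are instances used by the resolution behind is_derive_eq. *)
have d2 := is_derive1_powR r t0.
have d3 : is_derive t 1 (fun u => u `^ r - 1) (r * t `^ (r - 1)).
  by apply: is_derive_eq; rewrite subr0.
have d4 := is_derive1_inv (fun u => u `^ r - 1) t _ D d3.
by apply: is_derive_eq; rewrite /GRing.scale/=; field.
Unshelve. all: by end_near. Qed.

Lemma is_derive2_f (t : R) : 0 < t -> t != 1 ->
  is_derive t 1 ('D_1 (f r))
    (r * t `^ (r - 2) * curvature_num t / (t `^ r - 1) ^+ 3).
Proof.
move=> t0 tn1; have D := powR_sub1_neq0 (ltW t0) tn1.
apply: (@near_eq_is_derive R R^o R^o (fun u =>
    (u `^ r - 1 - (u - 1) * (r * u `^ (r - 1))) * ((u `^ r - 1) ^+ 2)^-1)).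
  near=> u; apply/esym.
  have u0 : 0 < u by near: u; exact: lt_nbhsr.
  have un1 : u != 1 by near: u; exact: near_neq.
  by have [] := is_derive_f u0 un1.
have d2 := is_derive1_powR r t0.
have d2' := is_derive1_powR (r - 1) t0.
have d3 : is_derive t 1 (fun u => (u `^ r - 1) ^+ 2)
    (2 * (t `^ r - 1) * (r * t `^ (r - 1))).
  by apply: is_derive_eq; rewrite /GRing.scale/=; ring.
have d4 := is_derive1_inv (fun u => (u `^ r - 1) ^+ 2) t _ (expf_neq0 2 D) d3.
apply: is_derive_eq; rewrite /GRing.scale/= /curvature_num powRD1 ?ltW//.
move: D; rewrite (powRB1 t0) (powRB2 t0) (_ : r - 1 - 1 = r - 2); last by ring.
by move=> D; field.
Unshelve. all: by end_near. Qed.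

Lemma continuous_f : continuous (f r).
Proof.
(* f r is even, so it suffices to treat t >= 0 and compose with the norm. *)
suff H (t : R) : 0 <= t -> {for t, continuous (f r)}.
  move=> x; rewrite (_ : f r = f r \o Num.norm); last first.
    by apply/funext => y /=; rewrite f_abs.
  by apply: continuous_comp; [exact: norm_continuous|exact: H].
rewrite le_eqVlt => /predU1P[<-|t0].
  have f0 : f r 0 = 1.
    have n01 : 0 != 1 :> R by rewrite eq_sym oner_eq0.
    by rewrite f_ratio// powR0 ?gt_eqF// divff// sub0r oppr_eq0 oner_eq0.
  rewrite /prop_for/continuous_at f0.
  (* Near 0, 1 - |u| <= f r u <= 1 because 0 <= |u|^r < 1. *)
  apply: (@squeeze_cvgr _ _ _ _ (fun u => 1 - `|u|) (cst 1)); last exact: cvg_cst.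
    near=> u; rewrite -f_abs f_le1// andbT.
    have u1 : `|u| < 1 by near: u; apply: (@nbhs0_lt _ R^o).
    rewrite f_ratio//; last by rewrite lt_eqF.
    have := powR_sub1_sign _ (negbT (lt_eqF u1)) => /(_ (normr_ge0 u)).
    rewrite nmulr_rgt0 subr_lt0// => P1.
    rewrite ler_ndivlMr ?subr_lt0//.
    have u1' : 0 <= 1 - `|u| by rewrite subr_ge0 ltW.
    by have := mulr_ge0 (powR_ge0 `|u| r) u1'; lra.
  rewrite -[in X in _ --> X](subr0 1) -[X in _ --> _ - X](@normr0 R R).
  by apply: cvgB; [exact: cvg_cst|exact: norm_continuous].
have [->|tn1] := eqVneq t 1; last first.
  have [+ _] := is_derive_f t0 tn1.
  by move=> /derivable1_diffP/differentiable_continuous.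
(* For t >= 0, f r t is the inverse of g t, where g is the slope function of t^r
   at 1, continuous there with value r. *)
have /is_derive1_caratheodory[g [gE cg g1]] := is_derive1_powR r (@ltr01 R).
have g1r : g 1 = r by rewrite g1 powR1 mulr1.
have gV : (g u)^-1 @[u --> (1 : R)] --> r^-1.
  have rn0 : r != 0 by rewrite gt_eqF.
  apply: (cvgV rn0); rewrite -[in X in _ --> X]g1r; exact: cg.
rewrite /prop_for/continuous_at f_at1; apply: cvg_trans gV.
apply: near_eq_cvg; near=> u.
have u0 : 0 <= u by apply: ltW; near: u; exact: lt_nbhsr.
have [->|un1] := eqVneq u 1; first by rewrite f_at1 g1r.
have D := powR_sub1_neq0 u0 un1.
have := gE u; rewrite powR1 f_ratio// => e.
have gu0 : g u != 0.
  by apply: contraNneq D => gu; rewrite e gu mul0r.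
by rewrite e invfM mulrCA mulfV ?mulr1// subr_eq0.
Unshelve. all: by end_near. Qed.

(** Away from 1 the sign of the second derivative decides; at the endpoints
    0 and 1 continuity is enough. *)
Lemma chord_convex_f_off1 (a b c : R) : 0 <= a -> a < b -> b < c ->
  c <= 1 \/ 1 <= a -> f r b * (c - a) <= f r a * (c - b) + f r c * (b - a).
Proof.
move=> a0 ab bc side.
have ac : a < c by exact: lt_trans bc.
have ca0 : 0 < c - a by rewrite subr_gt0.
have p0 : 0 <= (c - b) / (c - a) by rewrite divr_ge0// subr_ge0 ltW.
have p1 : (c - b) / (c - a) <= 1.
  by rewrite ler_pdivrMr// mul1r lerD2l lerN2 ltW.
have inside u : u \in `]a, c[%R -> 0 < u /\ u != 1.
  rewrite in_itv/= => /andP[au uc]; split; first exact: le_lt_trans au.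
  case: side => h; first by rewrite lt_eqF// (lt_le_trans uc).
  by rewrite gt_eqF// (le_lt_trans h).
pose p : {i01 R} := Itv01 p0 p1.
have bE : (c - b) / (c - a) * a + (1 - (c - b) / (c - a)) * c = b.
  by field; rewrite gt_eqF.
have := @second_derivative_convex R (f r) a c _ _ _ _ _ p (ltW ac).
rewrite !convRE /= /unstable.onem bE.
move=> H; have {H} : f r b <=
    (c - b) / (c - a) * f r a + (1 - (c - b) / (c - a)) * f r c.
  apply: H.
  - move=> u auc; have [u0 un1] : 0 < u /\ u != 1 by apply: inside; rewrite in_itv.
    have [_ ->] := is_derive2_f u0 un1.
    have D := powR_sub1_neq0 (ltW u0) un1.
    have -> : r * u `^ (r - 2) * curvature_num u / (u `^ r - 1) ^+ 3 =
        r * u `^ (r - 2) * ((u - 1) * curvature_num u) *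
        ((u - 1) * (u `^ r - 1)) / ((u - 1) * (u `^ r - 1) ^+ 2) ^+ 2.
      by field; rewrite D subr_eq0.
    rewrite divr_ge0 ?sqr_ge0// mulr_ge0//; last first.
      by apply: ltW; apply: powR_sub1_sign; rewrite ?ltW.
    rewrite mulr_ge0//; last by apply: curvature_num_sign; exact: ltW.
    by rewrite mulr_ge0 ?powR_ge0// ltW.
  - exact/cvg_at_left_filter/continuous_f.
  - exact/cvg_at_right_filter/continuous_f.
  - by move=> u /inside[u0 un1]; have [] := is_derive_f u0 un1.
  - by move=> u /inside[u0 un1]; have [] := is_derive2_f u0 un1.
rewrite -(ler_pM2r ca0); congr (_ <= _).
by field; rewrite gt_eqF.
Qed.

(** A chord whose base contains 1 in its interior is above the tangent at 1, hence
    above the point of the graph over 1; so it is also above the chord from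
    that point to either end, and each half of the graph is below the latter. *)
Lemma chord_convex_f : chord_convex (f r).
Proof.
move=> a b c a0 ab bc.
have ac : a < c by exact: lt_trans bc.
have c0 : 0 <= c by exact: le_trans (ltW ac).
have [c1|c1] := leP c 1; first by apply: chord_convex_f_off1 => //; left.
have [a1|a1] := leP 1 a; first by apply: chord_convex_f_off1 => //; right.
have ta := f_ge_tangent1 a0; have tc := f_ge_tangent1 c0.
have m1 : r^-1 * (c - a) <= f r a * (c - 1) + f r c * (1 - a).
  by nra.
have [b1|b1|b1] := ltgtP b 1; last by rewrite b1 f_at1.
- have := chord_convex_f_off1 a0 ab b1 (or_introl (lexx 1)).
  by rewrite f_at1; nra.
- have := chord_convex_f_off1 ler01 b1 bc (or_intror (lexx 1)).
  by rewrite f_at1; nra.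
Qed.

End ratio.

Theorem theorem1p3 (R : realType) (r : R) (hr : 1 <= r) :
  positive_definite (f r).
Proof.
split; first exact: continuous_f.
move=> m x _; split.
  apply/is_hermitianmxP; rewrite expr0 scale1r map_mx_id//.
  by apply/matrixP => i j; rewrite !mxE -f_abs distrC f_abs.
move=> c.
have := polya_pd_kernel (f r) 1 (f_ge0 hr) (f_le1 hr) (chord_convex_f hr)
  m x (c ^~ ord0).
congr (0 <= _); rewrite mxE exchange_big; apply: eq_bigr => j _.
rewrite mxE mulr_suml; apply: eq_bigr => i _.
by rewrite !mxE f_abs mulrAC.
Qed.
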